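(* Let $X,Y$ be reflexive Banach spaces, $B:X\to Y$ bounded and linear, $F:Y\to\mathbb{R}\cup\{\infty\}$ and $G:X\to\mathbb{R}\cup\{\infty\}$ proper, convex and lower semicontinuous, and let $E(v)=F(Bv)+G(v)$ for $v\in X$ and $D(q)=-F^*(q)-G^*(-B'q)$ for $q\in Y'$. Let $X_h\subset X$ and $Y_h\subset Y'$, and let $u\in X$ and $u_h\in X_h$ be minimal for $E$ in $X$ and in $X_h$, respectively. Let $\varrho_E:X\times X\to[0,\infty)$ be a coercivity functional, i.e., assume that $$\varrho_E(v,u)+E(u)\le E(v)\qquad\text{for all } v\in X .$$ Then the a priori error estimate $$\varrho_E(u_h,u)\le E(u_h)-E(u)\le \inf_{v_h\in X_h}E(v_h)-E(u)$$ holds. Moreover, for any $w_h\in X_h$ and $q_h\in Y_h$, with $\eta(w_h,q_h):=\bigl(E(w_h)-D(q_h)\bigr)^{1/2}$, the a posteriori error estimate $$\varrho_E(u_h,u)\le \eta^2(w_h,q_h)$$ holds.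
   Context: $X'$ and $Y'$ denote the dual spaces, $\langle\cdot,\cdot\rangle_{X',X}$ and $\langle\cdot,\cdot\rangle_{Y',Y}$ the duality pairings, and $B':Y'\to X'$ the adjoint of $B$. The Fenchel conjugates are $F^*(q)=\sup_{p\in Y}\langle q,p\rangle_{Y',Y}-F(p)$ for $q\in Y'$ and $G^*(v)=\sup_{u\in X}\langle v,u\rangle_{X',X}-G(u)$ for $v\in X'$. The minimal value $E(u)$ is understood to be finite, so that the energy differences are meaningful; $E(w_h)$ may equal $+\infty$ and $D(q_h)$ may equal $-\infty$, in which case $\eta(w_h,q_h)=+\infty$. *)

(* Defs.v *)
From HB Require Import structures.
From mathcomp Require Import all_boot all_order all_algebra.
From mathcomp Require Import mathcomp_extra boolp classical_sets functions.
From mathcomp Require Import reals constructive_ereal ereal topology normedtype.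

Set Implicit Arguments.
Unset Strict Implicit.
Unset Printing Implicit Defensive.

Import Order.TTheory GRing.Theory Num.Theory.
Import numFieldNormedType.Exports.

Local Open Scope classical_set_scope.
Local Open Scope ring_scope.

(** * Bounded linear operators, dual space, reflexivity *)

Section bounded_operator.
Context {R : realType} {X Y : normedModType R}.
Implicit Types f g : X -> Y.

Definition bounded_linear f :=
  linear f /\ exists M : R, forall x, `|f x| <= M * `|x|.

Definition bounded_linear_pred : {pred X -> Y} := mem [set f | bounded_linear f].

Lemma bounded_linear_closed : submod_closed bounded_linear_pred.
Proof.
split.
  rewrite inE /=; split; first by move=> a x y; rewrite scaler0 addr0.
  by exists 0 => x; rewrite normr0 mul0r.
move=> a f g; rewrite !inE /= => -[lf [M fM]] [lg [N gN]]; split.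
  move=> b x y; rewrite !fctE lf lg !scalerDr !scalerA (mulrC a b).
  by rewrite addrACA.
exists (`|a| * M + N) => x; rewrite !fctE mulrDl.
rewrite (le_trans (ler_normD _ _))// lerD// normrZ -mulrA ler_wpM2l//.
Qed.

HB.instance Definition _ :=
  GRing.isSubmodClosed.Build R (X -> Y) bounded_linear_pred bounded_linear_closed.

End bounded_operator.

Record bounded_operator (R : realType) (X Y : normedModType R) :=
  BoundedOperator {
    bounded_operator_fun :> X -> Y ;
    _ : bounded_operator_fun \in bounded_linear_pred }.

Section bounded_operator_norm.
Context {R : realType} {X Y : normedModType R}.
Implicit Types f g : bounded_operator X Y.

HB.instance Definition _ := [isSub for @bounded_operator_fun R X Y].
HB.instance Definition _ := [Choice of bounded_operator X Y by <:].
HB.instance Definition _ :=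
  [SubChoice_isSubLmodule of bounded_operator X Y by <:].

Lemma bounded_operatorP f : bounded_linear f.
Proof. by have := valP f; rewrite inE. Qed.

Lemma bounded_operator_linear f : linear f.
Proof. by case: (bounded_operatorP f). Qed.

HB.instance Definition _ f :=
  GRing.isLinear.Build R X Y *:%R f (@bounded_operator_linear f).

Definition operator_norm f : R :=
  sup [set `|f x| | x in [set x : X | `|x| <= 1]].

Lemma operator_norm_has_sup f :
  has_sup [set `|f x| | x in [set x : X | `|x| <= 1]].
Proof.
split; first by exists `|f 0|, 0 => //=; rewrite normr0.
have [_ [M fM]] := bounded_operatorP f.
exists `|M| => _ [x /= x1 <-]; apply: le_trans (fM x) _.
by rewrite (le_trans (ler_wpM2r _ (ler_norm M)))// ler_piMr.
Qed.

Lemma operator_norm_ub f x : `|x| <= 1 -> `|f x| <= operator_norm f.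
Proof.
by move=> x1; apply: (sup_upper_bound (operator_norm_has_sup f)); exists x.
Qed.

Lemma operator_norm_le f M :
  (forall x, `|x| <= 1 -> `|f x| <= M) -> operator_norm f <= M.
Proof.
move=> fM; apply: ge_sup; first by case: (operator_norm_has_sup f).
by move=> _ [x /= x1 <-]; exact: fM.
Qed.

Lemma operator_normP f x : `|f x| <= operator_norm f * `|x|.
Proof.
have [->|x0] := eqVneq x 0; first by rewrite linear0 !normr0 mulr0.
have nx0 : 0 < `|x| by rewrite normr_gt0.
rewrite -ler_pdivrMr//.
have := @operator_norm_ub f (`|x|^-1 *: x).
rewrite linearZ/= !normrZ normfV normr_id mulVf ?gt_eqF// => /(_ (lexx _)).
by rewrite mulrC.
Qed.

Lemma operator_norm_ge0 f : 0 <= operator_norm f.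
Proof. by have := @operator_norm_ub f 0; rewrite normr0 linear0 normr0; apply. Qed.

Lemma operator_normD f g :
  operator_norm (f + g) <= operator_norm f + operator_norm g.
Proof.
apply: operator_norm_le => x x1.
by rewrite (le_trans (ler_normD (f x) (g x)))// lerD// operator_norm_ub.
Qed.

Lemma operator_normZ (a : R) f : operator_norm (a *: f) = `|a| * operator_norm f.
Proof.
have le_normZ b h : operator_norm (b *: h) <= `|b| * operator_norm h.
  apply: operator_norm_le => x x1.
  by rewrite [leLHS](normrZ b (h x)) ler_wpM2l// operator_norm_ub.
apply/eqP; rewrite eq_le le_normZ/=.
have [->|a0] := eqVneq a 0; first by rewrite normr0 mul0r operator_norm_ge0.
have := le_normZ a^-1 (a *: f).
by rewrite scalerA mulVf// scale1r normfV ler_pdivlMl ?normr_gt0.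
Qed.

Lemma operator_norm0_eq0 f : operator_norm f = 0 -> f = 0.
Proof.
move=> f0; apply/val_inj/funext => x /=; apply/normr0_eq0/le_anti.
by rewrite normr_ge0 andbT -(mul0r `|x|) -f0 operator_normP.
Qed.

HB.instance Definition _ := Lmodule_isNormed.Build R (bounded_operator X Y)
  operator_normD operator_normZ operator_norm0_eq0.

End bounded_operator_norm.

Definition dual (R : realType) (X : normedModType R) : normedModType R :=
  bounded_operator X R.

Section adjoint.
Context {R : realType} {X Y : normedModType R} (B : bounded_operator X Y).

Lemma adjoint_subproof (q : dual Y) : q \o B \in @bounded_linear_pred R X R.
Proof.
rewrite inE /=; split.
  by move=> a x y; rewrite /= !linearP.
exists (operator_norm q * operator_norm B) => x /=.
by rewrite (le_trans (operator_normP _ _))// -mulrA ler_wpM2l ?operator_normP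
  ?operator_norm_ge0.
Qed.

Definition adjoint (q : dual Y) : dual X := BoundedOperator (adjoint_subproof q).

End adjoint.

Section reflexive.
Context {R : realType} (X : normedModType R).

Lemma bidual_eval_subproof (x : X) :
  (fun f : dual X => f x) \in @bounded_linear_pred R (dual X) R.
Proof.
rewrite inE /=; split; first by [].
by exists `|x| => f; rewrite mulrC; exact: operator_normP.
Qed.

Definition bidual_eval (x : X) : dual (dual X) :=
  BoundedOperator (bidual_eval_subproof x).

(* By Hahn-Banach, bidual_eval is always a linear isometry, so that only its
   surjectivity needs to be required. *)
Definition reflexive_space := range bidual_eval = [set: dual (dual X)].

End reflexive.

(** * Extended-real valued convex analysis *)

Local Open Scope ereal_scope.

Section convex_analysis.
Context {R : realType} {X : normedModType R}.
Implicit Types F : X -> \bar R.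

(* The first component says that F takes its values in R u {+oo}. *)
Definition proper_efun F := (forall x, -oo < F x) /\ exists x, F x < +oo.

(* The products 0 * +oo that occur for t = 0 and t = 1 are equal to 0. *)
Definition convex_efun F := forall (t : R) (x y : X), (0 <= t <= 1)%R ->
  F (t *: x + (1 - t) *: y)%R <= t%:E * F x + (1 - t)%:E * F y.

Definition fenchel_conjugate F (q : dual X) : \bar R :=
  ereal_sup [set (q x)%:E - F x | x in [set: X]].

End convex_analysis.

Definition minimal_in {R : realType} {T : Type} (E : T -> \bar R) (A : set T)
    (u : T) :=
  A u /\ forall v, A v -> E u <= E v.

Section energies.
Context {R : realType} {X Y : normedModType R}.
Variables (B : bounded_operator X Y) (F : Y -> \bar R) (G : X -> \bar R).

Definition primal_energy (v : X) : \bar R := F (B v) + G v.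

Definition dual_energy (q : dual Y) : \bar R :=
  - fenchel_conjugate F q - fenchel_conjugate G (- adjoint B q)%R.

Definition error_estimator (w : X) (q : dual Y) : \bar R :=
  sqrte (primal_energy w - dual_energy q).

End energies.

(* Main.v *)
Require Import Defs.
From mathcomp Require Import all_boot all_order all_algebra.
From mathcomp Require Import boolp classical_sets functions.
From mathcomp Require Import reals constructive_ereal ereal topology normedtype.

Import Order.TTheory GRing.Theory Num.Theory.

(** Both bounds compare energy differences with [E u_h - E u], which controls
    [rho_E(u_h, u)] because the coercivity inequality may be evaluated at
    [v := u_h] and the finite value [E u] moved to the other side.

    The a priori bound is then the minimality of [u_h] in [X_h], shifted by
    [E u].  For the a posteriori bound the unknown value [E u] is replaced by the
    computable lower bound [D q_h]: this is weak duality
    ([dual_energy_le_primal]).  It follows from the Fenchel-Young inequality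
    applied to [F] at [(q, B v)] and to [G] at [(- B' q, v)]: the two linear
    terms are [q (B v)] and [- (B' q) v = - q (B v)], and cancel in the sum.
    Hence [E w_h - D q_h >= E w_h - E u >= E u_h - E u >= rho_E(u_h, u)].  As the
    left-hand side is thus nonnegative, squaring its square root gives it back. *)

Local Open Scope classical_set_scope.
Local Open Scope ereal_scope.

(** The Fenchel-Young inequality [q x <= F x + F^* q], solved for [- F^* q]: in
    this form the sum on the right has a finite term and so cannot be
    [+oo - oo], whatever values [F] takes. *)
Lemma oppe_fenchel_conjugate_le {R : realType} {X : normedModType R}
  (F : X -> \bar R) (q : dual X) (x : X) :
  - fenchel_conjugate F q <= F x - (q x)%:E.
Proof.
rewrite leeNl fin_num_oppeB// addeC.
by apply: ereal_sup_ubound; exists x.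
Qed.

(** Weak duality: the linear terms of the two Fenchel-Young inequalities cancel
    by definition of the adjoint. *)
Lemma dual_energy_le_primal {R : realType} {X Y : normedModType R}
  (B : bounded_operator X Y) (F : Y -> \bar R) (G : X -> \bar R)
  (q : dual Y) (v : X) :
  dual_energy B F G q <= primal_energy B F G v.
Proof.
rewrite /dual_energy /primal_energy.
have FYF := oppe_fenchel_conjugate_le F q (B v).
have FYG := oppe_fenchel_conjugate_le G (- adjoint B q)%R v.
apply: le_trans (leeD FYF FYG) _.
have -> : (- adjoint B q)%R v = (- q (B v))%R by [].
by rewrite addeACA -oppeD// -EFinD subrr oppe0 adde0.
Qed.

Theorem proposition3p1 (R : realType) (X Y : completeNormedModType R)
  (reflX : reflexive_space X) (reflY : reflexive_space Y)
  (B : bounded_operator X Y) (F : Y -> \bar R) (G : X -> \bar R)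
  (properF : proper_efun F) (convexF : convex_efun F) (lscF : lower_semicontinuous F)
  (properG : proper_efun G) (convexG : convex_efun G) (lscG : lower_semicontinuous G)
  (Xh : set X) (Yh : set (dual Y)) (u uh : X)
  (u_min : minimal_in (primal_energy B F G) [set: X] u)
  (Eu_fin : primal_energy B F G u \is a fin_num)
  (uh_min : minimal_in (primal_energy B F G) Xh uh)
  (rho : X -> X -> R) (rho_ge0 : forall v w, (0 <= rho v w)%R)
  (rho_coercive : forall v,
     (rho v u)%:E + primal_energy B F G u <= primal_energy B F G v) :
  ((rho uh u)%:E <= primal_energy B F G uh - primal_energy B F G u /\
   primal_energy B F G uh - primal_energy B F G u <=
     ereal_inf [set primal_energy B F G vh - primal_energy B F G u | vh in Xh])
  /\
  (forall (wh : X) (qh : dual Y), Xh wh -> Yh qh ->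
     (rho uh u)%:E <= error_estimator B F G wh qh ^+ 2).
Proof.
have [_ uh_le] := uh_min.
have rho_le : (rho uh u)%:E <= primal_energy B F G uh - primal_energy B F G u.
  by rewrite leeBrDr.
split; first split=> //.
  by apply: le_ereal_inf_tmp => _ [v Xv <-]; rewrite leeB// uh_le.
move=> w q Xw _.
have rho_gap : (rho uh u)%:E <= primal_energy B F G w - dual_energy B F G q.
  apply: le_trans rho_le _.
  by rewrite leeB ?uh_le// dual_energy_le_primal.
rewrite /error_estimator sqr_sqrte// (le_trans _ rho_gap)// lee_fin.
exact: rho_ge0.
Qed.
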